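(* Let $(\mathbb{N},d)$ and $(\mathbb{N},\partial)$ be uniformly locally finite metric spaces, and let $E$ and $F$ be Banach spaces with a $d$-symmetric basis $\mathcal{E}$ and a $\partial$-symmetric basis $\mathcal{F}$, respectively. Suppose that $\mathrm{B}_u(d,\mathcal{E})$ and $\mathrm{B}_u(\partial,\mathcal{F})$ are simultaneously order and Banach algebra isomorphic, i.e., there is a Banach algebra isomorphism $\Phi:\mathrm{B}_u(d,\mathcal{E})\to\mathrm{B}_u(\partial,\mathcal{F})$ which is also an order isomorphism. Then $(\mathbb{N},d)$ and $(\mathbb{N},\partial)$ are bijectively coarsely equivalent.
   Context: All Banach spaces are complex, and ''basis'' means Schauder basis. For a basis $\mathcal{E}=(e_n)_n$ of $E$, $(e_n^* )_n$ denotes the biorthogonal functionals and $\mathcal{L}(E)$ the bounded operators on $E$. Given a metric $d$ on $\mathbb{N}$, $a\in\mathcal{L}(E)$ is a band operator (with respect to $\mathcal{E}$ and $d$) if there is $r>0$ such that $e_m^*(ae_n)=0$ whenever $d(n,m)>r$. $\mathrm{B}_u[d,\mathcal{E}]$ is the algebra of band operators, and the uniform Roe algebra $\mathrm{B}_u(d,\mathcal{E})$ is its operator-norm closure in $\mathcal{L}(E)$. A Banach algebra isomorphism is a bijective algebra homomorphism that is bounded with bounded inverse. A metric $d$ on $\mathbb{N}$ is uniformly locally finite if $\sup_{x\in\mathbb{N}}|B_r(x)|<\infty$ for all $r>0$, where $B_r(x)$ is the closed ball of radius $r$ about $x$. Order: $E_+=\{\sum_n a_ne_n\in E: a_n\ge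 0\ \forall n\}$; $a\in\mathcal{L}(E)$ is positive if $a(E_+)\subset E_+$, and $a\le b$ means $b-a$ is positive. $\mathrm{B}_u(d,\mathcal{E})$ carries the order inherited from $\mathcal{L}(E)$. A linear map between ordered Banach spaces is positive if it sends positive elements to positive elements, and is an order isomorphism if it is a positive bijection whose inverse is positive. $\mathcal{E}$ is unconditional if there is $\lambda\ge1$ with $\|\sum_{n\le k}\alpha_ne_n\|\le\lambda\|\sum_{n\le k}\beta_ne_n\|$ for all $k$ and all scalars with $|\alpha_n|\le|\beta_n|$. An unconditional basis $\mathcal{E}$ is $d$-symmetric if for all $r>0$ and all bijections $\sigma:A\to B$ between subsets $A,B\subset\mathbb{N}$ with $d(i,\sigma(i))\le r$ for all $i\in A$, there is $C>0$ such that $(e_n)_{n\in A}$ is $C$-equivalent to $(e_{\sigma(n)})_{n\in A}$, i.e. $C^{-1}\|\sum\alpha_ne_n\|\le\|\sum\alpha_ne_{\sigma(n)}\|\le C\|\sum\alpha_ne_n\|$ for all finitely supported scalar families $(\alpha_n)_{n\in A}$. A map $f:(X,d)\to(Y,\partial)$ is coarse if for all $r>0$ there is $s>0$ such that $d(x,y)<r$ implies $\partial(f(x),f(y))<s$; expanding if for all $s>0$ there is $r>0$ such that $d(x,y)>r$ implies $\partial(f(x),f(y))>s$; a coarse embedding if it is both coarse and expanding; a coarse equivalence if moreover $\sup_{y\in Y}\partial(y,f(X))<\infty$. Two spaces are bijectively coarsely equivalent if there is a bijective coarse equivalence between them. *)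

(* Defs.v *)
From HB Require Import structures.
From mathcomp Require Import all_boot all_order all_algebra.
From mathcomp Require Import complex.
From mathcomp Require Import all_classical all_reals all_analysis.

Set Implicit Arguments.
Unset Strict Implicit.
Unset Printing Implicit Defensive.

Import Order.TTheory GRing.Theory Num.Theory numFieldNormedType.Exports.

Local Open Scope classical_set_scope.
Local Open Scope ring_scope.
Local Open Scope complex_scope.

Section CoarseGeometry.
Context {R : realType}.

Definition is_metric (X : Type) (d : X -> X -> R) : Prop :=
  [/\ forall x y, 0 <= d x y,
      forall x y, d x y = 0 <-> x = y,
      forall x y, d x y = d y x
    & forall x y z, d x z <= d x y + d y z].

Definition uniformly_locally_finite (X : Type) (d : X -> X -> R) : Prop :=
  forall r : R, 0 < r ->
    exists N : nat, forall x, ([set y | d x y <= r] #<= `I_N)%card.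

Context {X Y : Type} (d : X -> X -> R) (d' : Y -> Y -> R).

Definition coarse (f : X -> Y) : Prop :=
  forall r : R, 0 < r -> exists2 s : R, 0 < s &
    forall x y, d x y < r -> d' (f x) (f y) < s.

Definition expanding (f : X -> Y) : Prop :=
  forall s : R, 0 < s -> exists2 r : R, 0 < r &
    forall x y, d x y > r -> d' (f x) (f y) > s.

Definition coarse_embedding (f : X -> Y) : Prop := coarse f /\ expanding f.

Definition dist_to_set (y : Y) (S : set Y) : R := inf [set d' y z | z in S].

Definition coarse_equivalence (f : X -> Y) : Prop :=
  coarse_embedding f /\
  has_ubound [set dist_to_set y (range f) | y in [set: Y]].

Definition bijectively_coarsely_equivalent : Prop :=
  exists2 f : X -> Y, bijective f & coarse_equivalence f.

End CoarseGeometry.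

Section Bases.
Context {R : realType} {E : completeNormedModType R[i]}.

(* The norm of a normed module over R[i] is R[i]-valued (with zero imaginary
   part); [rnorm] is the same norm seen in R. *)
Definition rnorm (x : E) : R := complex.Re `|x|.

Definition expansion (e : nat -> E) (x : E) (c : nat -> R[i]) : Prop :=
  series (fun n => c n *: e n) @ \oo --> x.

Definition schauder_basis (e : nat -> E) : Prop :=
  forall x, exists! c, expansion e x c.

(* [biorth e m] is the biorthogonal functional e_m^*; it is meaningful only
   when [e] is a Schauder basis. *)
Definition biorth (e : nat -> E) (m : nat) (x : E) : R[i] :=
  xget (fun=> 0) [set c | expansion e x c] m.

Definition unconditional_basis (e : nat -> E) : Prop :=
  schauder_basis e /\
  exists2 lambda : R, 1 <= lambda &
    forall (k : nat) (alpha beta : nat -> R[i]),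
      (forall n, `|alpha n| <= `|beta n|) ->
      rnorm (\sum_(n < k.+1) alpha n *: e n) <=
        lambda * rnorm (\sum_(n < k.+1) beta n *: e n).

Definition equivalent_families (C : R) (A : set nat) (u v : nat -> E) : Prop :=
  forall alpha : nat -> R[i],
    finite_set (A `&` [set n | alpha n != 0]) ->
    C^-1 * rnorm (\sum_(n \in A) alpha n *: u n)
      <= rnorm (\sum_(n \in A) alpha n *: v n)
      <= C * rnorm (\sum_(n \in A) alpha n *: u n).

Definition symmetric_basis (d : nat -> nat -> R) (e : nat -> E) : Prop :=
  unconditional_basis e /\
  forall r : R, 0 < r ->
  forall (A B : set nat) (sigma : nat -> nat), set_bij A B sigma ->
    (forall i, A i -> d i (sigma i) <= r) ->
    exists2 C : R, 0 < C & equivalent_families C A e (e \o sigma).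

(* Bounded operators are plain functions satisfying [bounded_operator], so that
   the algebra operations are the pointwise +, *: and composition \o. *)
Definition bounded_operator (a : E -> E) : Prop :=
  linear a /\ exists M : R, forall x, rnorm (a x) <= M * rnorm x.

Definition opnorm (a : E -> E) : R :=
  sup [set rnorm (a x) | x in [set x | rnorm x <= 1]].

Definition band_operator (d : nat -> nat -> R) (e : nat -> E) : set (E -> E) :=
  [set a | bounded_operator a /\
    exists2 r : R, 0 < r &
      forall n m, d n m > r -> biorth e m (a (e n)) = 0].

Definition uniform_roe (d : nat -> nat -> R) (e : nat -> E) : set (E -> E) :=
  [set a | bounded_operator a /\
    forall eps : R, 0 < eps ->
      exists2 b, band_operator d e b & opnorm (a - b) < eps].

Definition positive_cone (e : nat -> E) : set E :=
  [set x | forall n, 0 <= biorth e n x].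

Definition positive_operator (e : nat -> E) (a : E -> E) : Prop :=
  forall x, positive_cone e x -> positive_cone e (a x).

End Bases.

(* Maps between sets of operators are total functions of which only the
   restriction to the relevant set matters. *)
Definition inverse_on (S T : Type) (A : set S) (B : set T)
    (Phi : S -> T) (Psi : T -> S) : Prop :=
  [/\ forall a, A a -> B (Phi a), forall b, B b -> A (Psi b),
      forall a, A a -> Psi (Phi a) = a & forall b, B b -> Phi (Psi b) = b].

Section Isomorphisms.
Context {R : realType} {E F : completeNormedModType R[i]}.

Definition algebra_hom_on (A : set (E -> E)) (Phi : (E -> E) -> (F -> F)) :
    Prop :=
  [/\ forall a b, A a -> A b -> Phi (a + b) = Phi a + Phi b,
      forall (k : R[i]) a, A a -> Phi (k *: a) = k *: Phi a
    & forall a b, A a -> A b -> Phi (a \o b) = Phi a \o Phi b].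

Definition bounded_on (A : set (E -> E)) (Phi : (E -> E) -> (F -> F)) : Prop :=
  exists M : R, forall a, A a -> opnorm (Phi a) <= M * opnorm a.

Definition positive_on (e : nat -> E) (f : nat -> F) (A : set (E -> E))
    (Phi : (E -> E) -> (F -> F)) : Prop :=
  forall a, A a -> positive_operator e a -> positive_operator f (Phi a).

End Isomorphisms.

Definition banach_algebra_iso {R : realType} {E F : completeNormedModType R[i]}
    (A : set (E -> E)) (B : set (F -> F)) (Phi : (E -> E) -> (F -> F)) : Prop :=
  algebra_hom_on A Phi /\
  exists Psi : (F -> F) -> (E -> E),
    [/\ inverse_on A B Phi Psi, bounded_on A Phi & bounded_on B Psi].

Definition order_iso {R : realType} {E F : completeNormedModType R[i]}
    (e : nat -> E) (f : nat -> F)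
    (A : set (E -> E)) (B : set (F -> F)) (Phi : (E -> E) -> (F -> F)) : Prop :=
  exists Psi : (F -> F) -> (E -> E),
    [/\ inverse_on A B Phi Psi, positive_on e f A Phi & positive_on f e B Psi].

(* Main.v *)
Require Import Defs.
From HB Require Import structures.
From mathcomp Require Import all_boot all_order all_algebra.
From mathcomp Require Import complex.
From mathcomp Require Import lra.
From mathcomp Require Import all_classical all_reals all_analysis.

Import Order.TTheory GRing.Theory Num.Theory numFieldNormedType.Exports.

Local Open Scope classical_set_scope.
Local Open Scope ring_scope.
Local Open Scope complex_scope.

(** The diagonal 0/1 operators are the idempotents [q] with [0 <= q <= 1], and
    these conditions are preserved by an isomorphism [Phi] of ordered algebras.
    Hence [Phi] permutes the rank-one diagonal projections: it sends [D_n] to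
    [D_(s n)] for a permutation [s] of the natural numbers.  If [s] were not
    coarse, there would be injective sequences [x], [y] with [d (x k) (y k)]
    bounded and [d' (s (x k)) (s (y k))] unbounded; by [d]-symmetry,
    [e_(x k) |-> e_(y k)] extends to a bounded band operator [v].  The corner
    [D_(s (y k)) (Phi v) D_(s (x k))] becomes arbitrarily small, because [Phi v]
    is a limit of band operators, whereas its preimage [D_(y k) v D_(x k)] maps
    [e_(x k)] to [e_(y k)], whose norms are comparable.  The same argument for
    [Phi^-1] shows that the inverse of [s] is coarse. *)

(** * The real-valued norm and convergence with respect to it *)

Section RealNorm.
Context {R : realType} {E : completeNormedModType R[i]}.
Implicit Types (x y : E) (u : nat -> E).

Lemma normr_rnorm x : `|x| = (rnorm x)%:C.
Proof.
have := normr_ge0 x; rewrite /rnorm lecE /= => /andP[/eqP h _].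
by case: `|x| h => a b /= ->.
Qed.

Lemma rnorm_ge0 x : 0 <= rnorm x.
Proof. by rewrite -lecR -normr_rnorm normr_ge0. Qed.

Lemma rnorm0 : rnorm (0 : E) = 0.
Proof. by rewrite /rnorm normr0. Qed.

Lemma rnorm0_eq0 x : rnorm x = 0 -> x = 0.
Proof. by move=> h; apply/eqP; rewrite -normr_eq0 normr_rnorm h. Qed.

Lemma ler_rnormD x y : rnorm (x + y) <= rnorm x + rnorm y.
Proof. by rewrite -lecR rmorphD /= -!normr_rnorm ler_normD. Qed.

Lemma rnorm_distC x y : rnorm (x - y) = rnorm (y - x).
Proof. by rewrite /rnorm distrC. Qed.

(** A positive element of [R[i]] has zero imaginary part, so complex and real radii amount to the
    same. *)
Lemma cvg_rnormP u x :
  (u @ \oo --> x) <->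
  (forall eps : R, 0 < eps -> \forall n \near \oo, rnorm (x - u n) < eps).
Proof.
split.
  move/cvgrPdist_lt => h eps eps0.
  have := h eps%:C; rewrite ltcR => /(_ eps0).
  by apply: filterS => n; rewrite normr_rnorm ltcR.
move=> h; apply/cvgrPdist_lt => eps eps0.
have e0 : 0 < complex.Re eps by move: eps0; rewrite ltcE /= => /andP[].
have -> : eps = (complex.Re eps)%:C.
  by move: eps0; rewrite ltcE /= => /andP[/eqP]; case: eps {e0} => a b /= ->.
by apply: filterS (h _ e0) => n; rewrite normr_rnorm ltcR.
Qed.

Lemma cvg_rnorm u x : u @ \oo --> x -> (fun n => rnorm (u n)) @ \oo --> rnorm x.
Proof.
move/cvg_rnormP => h; apply/cvgrPdist_lt => eps /h.
apply: filterS => n; apply: le_lt_trans.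
have := ler_rnormD (u n) (x - u n); have := ler_rnormD x (u n - x).
rewrite ![_ + (_ - _)]addrC !subrK rnorm_distC ler_norml => h1 h2.
by apply/andP; split; lra.
Qed.

Lemma cvg_vec_unique u x y : u @ \oo --> x -> u @ \oo --> y -> x = y.
Proof. by move=> ux uy; apply: cvg_unique ux uy; exact: norm_hausdorff. Qed.

End RealNorm.

Lemma ler_rnorm_cvg {R : realType} {E F : completeNormedModType R[i]} (K : R)
    (u : nat -> E) (v : nat -> F) x y :
  u @ \oo --> x -> v @ \oo --> y ->
  (forall n, rnorm (v n) <= K * rnorm (u n)) -> rnorm y <= K * rnorm x.
Proof.
move=> /cvg_rnorm ux /cvg_rnorm vy h.
have Ku : (fun n => K * rnorm (u n)) @ \oo --> K * rnorm x by apply: cvgMl_tmp.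
by apply: ler_cvg_to vy Ku _; apply: nearW.
Qed.

Lemma dominated_series_cvg {R : realType} {E F : completeNormedModType R[i]} (K : R)
    (u : nat -> E) (v : nat -> F) :
  0 <= K -> cvg (series u @ \oo) ->
  (forall m n, rnorm (\sum_(m <= k < n) v k) <= K * rnorm (\sum_(m <= k < n) u k)) ->
  cvg (series v @ \oo).
Proof.
move=> K0 /cauchy_cvgP/cauchy_seriesP cu h; apply/cauchy_cvgP/cauchy_seriesP => eps eps0.
(* Dividing by [K + 1] instead of [K] covers the case [K = 0]. *)
have K1 : 0 < (K + 1)%:C by rewrite ltcR; lra.
have := cu (eps / (K + 1)%:C) (divr_gt0 eps0 K1).
apply: filterS => -[m n] /=; rewrite ltr_pdivlMr // => uK; apply: le_lt_trans uK.
rewrite !normr_rnorm -rmorphM /= lecR (le_trans (h m n)) // mulrC ler_wpM2l ?rnorm_ge0 //.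
lra.
Qed.

(* The limit is a junk value unless the series converges, which [basis_opP]
   ensures under a domination hypothesis. *)
Definition basis_op {R : realType} {E : completeNormedModType R[i]} (e u : nat -> E)
    (x : E) : E :=
  limn (series (fun n => biorth e n x *: u n)).

Definition diag_op {R : realType} {E : completeNormedModType R[i]} (e : nat -> E)
    (A : set nat) : E -> E :=
  basis_op e (fun n => (n \in A)%:R *: e n).

(** * Coefficients, and operators prescribed on a basis *)

Section Basis.
Context {R : realType} {E : completeNormedModType R[i]} (e : nat -> E).
Hypothesis e_unc : unconditional_basis e.

Let e_basis : schauder_basis e. Proof. by case: e_unc. Qed.

Lemma expansion_biorth x : expansion e x (fun n => biorth e n x).
Proof.
rewrite /biorth; case: xgetP => [c -> //|none].
by have [c [ec _]] := e_basis x; have := none c.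
Qed.

Lemma biorthE x c : expansion e x c -> forall n, biorth e n x = c n.
Proof.
move=> ec n; have [c0 [_ uniq]] := e_basis x.
by rewrite -[RHS](congr1 (@^~ n) (uniq _ ec)) (congr1 (@^~ n) (uniq _ (expansion_biorth x))).
Qed.

Lemma expansion_ext x y c : expansion e x c -> expansion e y c -> x = y.
Proof. exact: cvg_vec_unique. Qed.

Lemma biorth_inj x y : (forall n, biorth e n x = biorth e n y) -> x = y.
Proof.
move=> xy; apply: expansion_ext (expansion_biorth y).
by rewrite -(funext xy); exact: expansion_biorth.
Qed.

Lemma biorthZD k x y n : biorth e n (k *: x + y) = k * biorth e n x + biorth e n y.
Proof.
apply: (@biorthE _ (fun n => k * biorth e n x + biorth e n y)).
rewrite /expansion.
have -> : series (fun n => (k * biorth e n x + biorth e n y) *: e n) =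
    (k \*: series (fun n => biorth e n x *: e n)) + series (fun n => biorth e n y *: e n).
  apply/funext => m; rewrite fctE /series /= scaler_sumr -big_split /=.
  by apply: eq_bigr => i _; rewrite scalerDl scalerA.
by apply: cvgD; [apply: cvgZl_tmp|]; exact: expansion_biorth.
Qed.

Lemma biorth0 n : biorth e n 0 = 0.
Proof. by have := biorthZD (-1) 0 0 n; rewrite scaler0 addr0 mulN1r addNr. Qed.

Lemma biorthZ k x n : biorth e n (k *: x) = k * biorth e n x.
Proof. by rewrite -[k *: x]addr0 biorthZD biorth0 addr0. Qed.

Lemma biorthD x y n : biorth e n (x + y) = biorth e n x + biorth e n y.
Proof. by rewrite -[x]scale1r biorthZD scale1r mul1r. Qed.

Lemma biorth_basis m n : biorth e m (e n) = (m == n)%:R.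
Proof.
apply: (@biorthE _ (fun m => (m == n)%:R)).
apply/cvg_rnormP => eps eps0; exists n.+1 => //= k /= nk.
rewrite /series /= big_mkord (bigD1 (Ordinal nk)) //= eqxx scale1r big1 ?addr0 ?subrr ?rnorm0 //.
by move=> i; rewrite -val_eqE /= => /negPf ->; rewrite scale0r.
Qed.

Lemma basis_neq0 n : e n != 0.
Proof.
apply/eqP => en; have := biorth_basis n n.
by rewrite en biorth0 eqxx => /esym/eqP; rewrite oner_eq0.
Qed.

Lemma rnorm_basis_gt0 n : 0 < rnorm (e n).
Proof.
rewrite lt_neqAle rnorm_ge0 andbT eq_sym; apply: contraNneq (basis_neq0 n) => h.
by apply/eqP; exact: rnorm0_eq0.
Qed.

(** Domination makes the defining series Cauchy, and the bound survives the limit. Diagonal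
    operators and partial translations are both built this way. *)
Lemma basis_opP (K : R) (u : nat -> E) :
    0 <= K ->
    (forall n (c : nat -> R[i]), rnorm (\sum_(0 <= k < n) c k *: u k) <=
       K * rnorm (\sum_(0 <= k < n) c k *: e k)) ->
  [/\ linear (basis_op e u),
      forall x, rnorm (basis_op e u x) <= K * rnorm x,
      forall n, basis_op e u (e n) = u n &
      forall x, series (fun n => biorth e n x *: u n) @ \oo --> basis_op e u x].
Proof.
move=> K0 dom.
have cvT x : cvg (series (fun n => biorth e n x *: u n) @ \oo).
  apply: (@dominated_series_cvg _ _ _ K (fun n => biorth e n x *: e n)) => //.
    by apply/cvg_ex; exists x; exact: expansion_biorth.
  (* The domination hypothesis concerns sums starting at [0]; zeroing the coefficients below [m]
     turns them into tail sums. *)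
  move=> m n; have := dom n (fun k => (m <= k)%N%:R * biorth e k x).
  have tail (w : nat -> E) :
      \sum_(0 <= k < n) ((m <= k)%N%:R * biorth e k x) *: w k =
      \sum_(m <= k < n) biorth e k x *: w k.
    rewrite (big_nat_widenl m 0) // !big_mkord [RHS]big_mkcond /=.
    by apply: eq_bigr => i _; case: leqP => _; rewrite ?mul1r ?mul0r ?scale0r.
  by rewrite !tail.
split.
- move=> k x y; apply/cvg_lim; first exact: norm_hausdorff.
  have -> : series (fun n => biorth e n (k *: x + y) *: u n) =
      (k \*: series (fun n => biorth e n x *: u n)) + series (fun n => biorth e n y *: u n).
    apply/funext => m; rewrite fctE /series /= scaler_sumr -big_split /=.
    by apply: eq_bigr => i _; rewrite biorthZD scalerDl scalerA.
  by apply: cvgD; [apply: cvgZl_tmp|]; exact: cvT.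
- move=> x; apply: ler_rnorm_cvg (expansion_biorth x) (cvT x) _ => n; exact: dom.
- move=> n; apply/cvg_lim; first exact: norm_hausdorff.
  apply/cvg_rnormP => eps eps0; exists n.+1 => //= k /= nk.
  rewrite /series /= big_mkord (bigD1 (Ordinal nk)) //= biorth_basis eqxx scale1r.
  rewrite big1 ?addr0 ?subrr ?rnorm0 // => i; rewrite -val_eqE biorth_basis /= => /negPf ->.
  by rewrite scale0r.
- exact: cvT.
Qed.

Lemma unconditional_sum : exists2 lambda : R, 1 <= lambda &
  forall n (a b : nat -> R[i]), (forall k, `|a k| <= `|b k|) ->
    rnorm (\sum_(0 <= k < n) a k *: e k) <= lambda * rnorm (\sum_(0 <= k < n) b k *: e k).
Proof.
have [_ [l l1 dom]] := e_unc; exists l => // -[|n] a b ab; last by rewrite !big_mkord dom.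
by rewrite !big_geq // rnorm0 mulr0.
Qed.

(** Factors 0 and 1 do not increase the moduli of coefficients, so unconditionality applies. A
    single [lambda] serves all [A], which the corner estimates rely on, as their index sets vary. *)
Lemma diag_opP : exists2 lambda : R, 0 < lambda &
  forall A, [/\ linear (diag_op e A),
    forall x, rnorm (diag_op e A x) <= lambda * rnorm x &
    forall n x, biorth e n (diag_op e A x) = (n \in A)%:R * biorth e n x].
Proof.
have [l l1 dom] := unconditional_sum; have l0 : 0 < l by lra.
exists l => // {}A; have [||T1 T2 T3 T4] := @basis_opP l (fun n => (n \in A)%:R *: e n).
- exact: ltW.
- move=> n c; under eq_bigr do rewrite scalerA; apply: dom => k.
  by rewrite normrM normr_nat ler_piMr // lern1 leq_b1.
split => // n x; rewrite (@biorthE _ (fun n => (n \in A)%:R * biorth e n x)) //.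
rewrite /expansion.
have -> : (fun n => ((n \in A)%:R * biorth e n x) *: e n) =
    (fun n => biorth e n x *: ((n \in A)%:R *: e n)).
  by apply/funext => k; rewrite scalerA mulrC.
exact: T4.
Qed.

End Basis.

(** * Bounded operators and the operator norm *)

Section Operators.
Context {R : realType} {E : completeNormedModType R[i]}.
Implicit Types (a b : E -> E).

Lemma rnormZ (k : R) (x : E) : 0 <= k -> rnorm (k%:C *: x) = k * rnorm x.
Proof.
move=> k0; apply: (@complexI R); rewrite rmorphM /= -!normr_rnorm normrZ ger0_norm //.
by rewrite lecR.
Qed.

Lemma bounded_operator0 a : bounded_operator a -> a 0 = 0.
Proof. by case=> la _; have := la (-1) 0 0; rewrite scaler0 addr0 scaleN1r addNr. Qed.

Lemma bounded_operatorZ a k x : bounded_operator a -> a (k *: x) = k *: a x.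
Proof. by move=> ba; have := ba.1 k x 0; rewrite (bounded_operator0 _ ba) !addr0. Qed.

Lemma bounded_operatorD a x y : bounded_operator a -> a (x + y) = a x + a y.
Proof. by move=> ba; have := ba.1 1 x y; rewrite !scale1r. Qed.

Lemma bounded_operatorB a x y : bounded_operator a -> a (x - y) = a x - a y.
Proof.
by move=> ba; rewrite bounded_operatorD // -scaleN1r bounded_operatorZ // scaleN1r.
Qed.

Lemma bounded_operator_sub a b :
  bounded_operator a -> bounded_operator b -> bounded_operator (a - b).
Proof.
move=> [la [M aM]] [lb [N bN]]; split.
  by move=> k x y; rewrite !fctE la lb scalerBr opprD addrACA.
exists (M + N) => x; rewrite !fctE mulrDl; apply: le_trans (ler_rnormD _ _) _.
by apply: lerD => //; rewrite /rnorm normrN; exact: bN.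
Qed.

Lemma bounded_operator_comp a b :
  bounded_operator a -> bounded_operator b -> bounded_operator (a \o b).
Proof.
move=> [la [M aM]] [lb [N bN]]; split; first by move=> k x y /=; rewrite lb la.
exists (`|M| * N) => x /=; apply: le_trans (aM _) _.
rewrite -mulrA; apply: le_trans (ler_wpM2l (normr_ge0 M) (bN x)).
by rewrite ler_wpM2r ?rnorm_ge0 ?ler_norm.
Qed.

Let opnorm_ubound a M : (forall x, rnorm (a x) <= M * rnorm x) ->
  has_sup [set rnorm (a x) | x in [set x | rnorm x <= 1]].
Proof.
move=> aM; split; first by exists (rnorm (a 0)); exists 0; rewrite /= ?rnorm0.
(* [M] may be negative when the space is trivial, hence the absolute value. *)
exists `|M| => _ [x /= x1 <-]; apply: le_trans (aM x) _.
apply: (@le_trans _ _ (`|M| * rnorm x)); first by rewrite ler_wpM2r ?rnorm_ge0 ?ler_norm.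
by rewrite ler_piMr.
Qed.

Lemma opnorm_ge0 a : bounded_operator a -> 0 <= opnorm a.
Proof.
move=> ba; have [_ [M /opnorm_ubound/sup_upper_bound]] := ba; apply.
by exists 0; rewrite /= ?bounded_operator0 ?rnorm0.
Qed.

Lemma ler_opnorm a x : bounded_operator a -> rnorm (a x) <= opnorm a * rnorm x.
Proof.
move=> ba; have [_ [M /opnorm_ubound/sup_upper_bound ub]] := ba.
have [->|x0] := eqVneq x 0; first by rewrite bounded_operator0 // rnorm0 mulr0.
have nx : 0 < rnorm x.
  by rewrite lt_neqAle rnorm_ge0 andbT eq_sym; apply: contraNneq x0 => /rnorm0_eq0 ->.
rewrite -ler_pdivrMr // mulrC -rnormZ ?invr_ge0 ?rnorm_ge0 // -bounded_operatorZ //.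
apply: ub; exists ((rnorm x)^-1%:C *: x) => //=.
by rewrite rnormZ ?invr_ge0 ?rnorm_ge0 // mulVf // gt_eqF.
Qed.

Lemma opnorm_le a K : 0 <= K -> (forall x, rnorm (a x) <= K * rnorm x) -> opnorm a <= K.
Proof.
move=> K0 aK; apply: ge_sup; first by exists (rnorm (a 0)); exists 0; rewrite /= ?rnorm0.
by move=> _ [x /= x1 <-]; apply: le_trans (aK x) _; rewrite ler_piMr.
Qed.

Lemma opnorm0 : opnorm (0 : E -> E) <= 0.
Proof. by apply: opnorm_le => // x; rewrite mul0r rnorm0. Qed.

Lemma bounded_operator_sum a n (c : nat -> R[i]) (u : nat -> E) :
  bounded_operator a -> a (\sum_(0 <= k < n) c k *: u k) = \sum_(0 <= k < n) c k *: a (u k).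
Proof.
move=> ba; elim: n => [|n IH]; first by rewrite !big_geq // bounded_operator0.
by rewrite !big_nat_recr //= bounded_operatorD // IH bounded_operatorZ.
Qed.

Lemma bounded_operator_expansion a (e : nat -> E) x c : bounded_operator a ->
  expansion e x c -> expansion (a \o e) (a x) c.
Proof.
move=> ba /cvg_rnormP ex; apply/cvg_rnormP => eps eps0.
have na : 0 < opnorm a + 1 by have := opnorm_ge0 _ ba; lra.
apply: filterS (ex _ (divr_gt0 eps0 na)) => n; rewrite /series /= ltr_pdivlMr // => xn.
rewrite -bounded_operator_sum // -bounded_operatorB //.
apply: le_lt_trans (ler_opnorm _ _ ba) _; apply: le_lt_trans xn.
by rewrite mulrC ler_wpM2l ?rnorm_ge0 //; lra.
Qed.

(** Both values at [x] are limits of the same series, obtained by applying the operators term by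
    term to the expansion of [x]. *)
Lemma eq_on_basis (e : nat -> E) a b : unconditional_basis e ->
  bounded_operator a -> bounded_operator b -> (forall n, a (e n) = b (e n)) -> a = b.
Proof.
move=> eu ba bb ab; apply/funext => x.
have ex := expansion_biorth _ eu x.
have := bounded_operator_expansion _ _ _ _ ba ex.
have -> : a \o e = b \o e by exact/funext.
by move/cvg_vec_unique; apply; exact: bounded_operator_expansion.
Qed.

End Operators.

(** * Diagonal operators in the uniform Roe algebra *)

Section Roe.
Context {R : realType} {E : completeNormedModType R[i]} (e : nat -> E) (d : nat -> nat -> R).
Hypotheses (e_unc : unconditional_basis e) (d_metric : is_metric d).

Lemma band_roe a : band_operator d e a -> uniform_roe d e a.
Proof.
move=> ba; split; first by case: ba.
by move=> eps eps0; exists a => //; rewrite subrr; apply: le_lt_trans opnorm0 eps0.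
Qed.

Lemma biorth_diag A n x : biorth e n (diag_op e A x) = (n \in A)%:R * biorth e n x.
Proof. by have [l _ /(_ A)[]] := diag_opP _ e_unc. Qed.

Lemma bounded_diag A : bounded_operator (diag_op e A).
Proof. by have [l _ /(_ A)[? ? _]] := diag_opP _ e_unc; split => //; exists l. Qed.

Lemma diag_basis A n : diag_op e A (e n) = (n \in A)%:R *: e n.
Proof.
apply: (biorth_inj _ e_unc) => m; rewrite biorth_diag biorthZ // biorth_basis //.
by case: eqVneq => [->//|]; rewrite !mulr0.
Qed.

Lemma diag_comp A B : diag_op e A \o diag_op e B = diag_op e (A `&` B).
Proof.
apply/funext => x; apply: (biorth_inj _ e_unc) => m.
by rewrite !biorth_diag mulrA -natrM mulnb in_setI.
Qed.

Lemma diag_set1 n x : diag_op e [set n] x = biorth e n x *: e n.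
Proof.
apply: (biorth_inj _ e_unc) => m; rewrite biorth_diag biorthZ // biorth_basis // in_set1.
by case: eqVneq => [->|]; rewrite ?mulr1 ?mul1r // mulr0 mul0r.
Qed.

Lemma diag_setT : diag_op e setT = id.
Proof.
by apply/funext => x; apply: (biorth_inj _ e_unc) => m; rewrite biorth_diag in_setT mul1r.
Qed.

Lemma diagD_setC A : diag_op e A + diag_op e (~` A) = id.
Proof.
apply/funext => x; apply: (biorth_inj _ e_unc) => m; rewrite fctE biorthD // !biorth_diag.
by rewrite -mulrDl -natrD in_setC; case: (m \in A); rewrite mul1r.
Qed.

Lemma diag_positive A : positive_operator e (diag_op e A).
Proof. by move=> x x0 n; rewrite biorth_diag mulr_ge0. Qed.

Lemma band_diag A : band_operator d e (diag_op e A).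
Proof.
split; first exact: bounded_diag.
exists 1 => // n m dnm; rewrite diag_basis biorthZ // biorth_basis //.
have [mn|] := eqVneq m n; last by rewrite mulr0.
have [_ /(_ n m)[_ /(_ (esym mn)) d0] _ _] := d_metric.
by move: dnm; rewrite d0 ltr10.
Qed.

(** A diagonal factor only deletes matrix entries, so a band approximant keeps its width, and the
    error grows at most by the factor [l]. With the product on the other side this yields the
    corners [D_y a D_x]. *)
Lemma roe_diagl A a : uniform_roe d e a -> uniform_roe d e (diag_op e A \o a).
Proof.
move=> [ba roe]; have [l l0 /(_ A)[_ lA _]] := diag_opP _ e_unc.
split; first exact: bounded_operator_comp (bounded_diag A) ba.
move=> eps eps0; have [b [bb [r r0 bandb]] ab] := roe _ (divr_gt0 eps0 l0).
exists (diag_op e A \o b).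
  split; first exact: bounded_operator_comp (bounded_diag A) bb.
  by exists r => // n m /bandb bnm; rewrite /= biorth_diag bnm mulr0.
have bab := bounded_operator_sub _ _ ba bb.
apply: (@le_lt_trans _ _ (l * opnorm (a - b))); last by rewrite mulrC -ltr_pdivlMr.
apply: opnorm_le => [|x]; first by rewrite mulr_ge0 ?(ltW l0) ?opnorm_ge0.
rewrite !fctE /= -bounded_operatorB; last exact: bounded_diag.
apply: le_trans (lA _) _; rewrite -mulrA ler_wpM2l ?(ltW l0) //.
exact: (ler_opnorm (a - b)).
Qed.

Lemma roe_diagr A a : uniform_roe d e a -> uniform_roe d e (a \o diag_op e A).
Proof.
move=> [ba roe]; have [l l0 /(_ A)[_ lA _]] := diag_opP _ e_unc.
split; first exact: bounded_operator_comp ba (bounded_diag A).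
move=> eps eps0; have [b [bb [r r0 bandb]] ab] := roe _ (divr_gt0 eps0 l0).
exists (b \o diag_op e A).
  split; first exact: bounded_operator_comp bb (bounded_diag A).
  exists r => // n m /bandb bnm.
  by rewrite /= diag_basis bounded_operatorZ // biorthZ // bnm mulr0.
have bab := bounded_operator_sub _ _ ba bb.
apply: (@le_lt_trans _ _ (opnorm (a - b) * l)); last by rewrite -ltr_pdivlMr.
apply: opnorm_le => [|x]; first by rewrite mulr_ge0 ?(ltW l0) ?opnorm_ge0.
apply: le_trans (ler_opnorm (a - b) _ bab) _.
by rewrite -mulrA ler_wpM2l ?opnorm_ge0.
Qed.

(** For [m != n] the [m]-th coefficients of [p (e n)] and [q (e n)] are nonnegative with sum 0, so
    [q (e n) = t n *: e n]. Idempotency then leaves only 0 and 1 for [t n]. The operator [p] encodes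
    [q <= 1]. *)
Lemma positive_idempotent_diag p q : bounded_operator q ->
  p + q = id -> positive_operator e p -> positive_operator e q -> q \o q = q ->
  exists A, q = diag_op e A.
Proof.
move=> bq pq p0 q0 qq; pose t n := biorth e n (q (e n)).
have basis_ge0 n : positive_cone e (e n) by move=> m; rewrite biorth_basis.
have qe n : q (e n) = t n *: e n.
  apply: (biorth_inj _ e_unc) => m; rewrite biorthZ // biorth_basis //.
  have [->|mn] := eqVneq m n; first by rewrite mulr1.
  have := congr1 (biorth e m) (congr1 (@^~ (e n)) pq).
  rewrite fctE biorthD // biorth_basis // (negPf mn) => /eqP.
  rewrite paddr_eq0 ?(p0 _ (basis_ge0 n)) ?(q0 _ (basis_ge0 n)) //.
  by case/andP => _ /eqP ->; rewrite mulr0.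
have tt n : t n = (n \in [set n | t n = 1])%:R.
  have := congr1 (@^~ (e n)) qq; rewrite /= qe bounded_operatorZ // qe scalerA.
  move/(congr1 (biorth e n)); rewrite !biorthZ // biorth_basis // eqxx !mulr1 => /eqP.
  rewrite -subr_eq0 -{3}[t n]mulr1 -mulrBr mulf_eq0 subr_eq0 => /orP[]/eqP t01.
    by rewrite t01 memNset //= t01 => /esym/eqP; rewrite oner_eq0.
  by rewrite mem_set.
exists [set n | t n = 1]; apply: (eq_on_basis e) => //; first exact: bounded_diag.
by move=> n; rewrite qe diag_basis -tt.
Qed.

End Roe.

(** * Partial translations *)

Lemma fsum_truncated {R : realType} {E : completeNormedModType R[i]} (A : set nat) n
    (c : nat -> R[i]) (w : nat -> E) :
  \sum_(k \in A) ((k \in A) && (k < n)%N)%:R * c k *: w k =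
  \sum_(0 <= k < n) c k *: ((k \in A)%:R *: w k).
Proof.
rewrite (fsbigE [seq k <- index_iota 0 n | k \in A]) //.
- rewrite big_filter_cond big_mkcond !big_mkord; apply: eq_bigr => i _.
  rewrite ltn_ord andbT andbb; case: (_ \in A) => /=; rewrite ?mul1r ?scale1r //.
  by rewrite scale0r scaler0.
- by rewrite filter_uniq ?iota_uniq.
- by move=> k /=; rewrite mem_filter => /andP[/set_mem].
move=> k /mem_set kA; rewrite mem_filter kA mem_index_iota /= => /negPf ->.
by rewrite mul0r scale0r.
Qed.

Section PartialTranslation.
Context {R : realType} {E : completeNormedModType R[i]} (e : nat -> E) (d : nat -> nat -> R).
Hypothesis e_sym : symmetric_basis d e.

(** The operator [v] kills the basis vectors outside [A]. Its bound is [C * l]: unconditionality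
    pays [l] for restricting a vector to [A], and symmetry pays [C] for moving it along [sigma]. *)
Lemma partial_translation r (A B : set nat) (sigma : nat -> nat) : 0 < r ->
  set_bij A B sigma -> (forall i, A i -> d i (sigma i) <= r) ->
  exists v : E -> E, exists C : R,
    [/\ band_operator d e v, 0 < C,
        forall i, A i -> v (e i) = e (sigma i) &
        forall i, A i -> rnorm (e i) <= C * rnorm (e (sigma i))].
Proof.
move=> r0 bij_s close; have [e_unc sym] := e_sym.
have [C C0 eqC] := sym r r0 A B sigma bij_s close.
have [l l1 dom] := unconditional_sum e e_unc.
pose u i := (i \in A)%:R *: e (sigma i).
have equ n c : C^-1 * rnorm (\sum_(0 <= k < n) c k *: ((k \in A)%:R *: e k)) <=
    rnorm (\sum_(0 <= k < n) c k *: u k) <=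
    C * rnorm (\sum_(0 <= k < n) c k *: ((k \in A)%:R *: e k)).
  (* Symmetry speaks of finitely supported families on [A]; cutting the coefficients at [n] makes it
     apply to partial sums. *)
  have := eqC (fun k => ((k \in A) && (k < n)%N)%:R * c k); rewrite !fsum_truncated.
  apply; apply: (@sub_finite_set _ _ `I_n); last exact: finite_II.
  by move=> k [_ /=]; case: ltnP => //; rewrite andbF mul0r eqxx.
have Cl0 : 0 <= C * l by rewrite mulr_ge0 ?(ltW C0) //; lra.
have [|v1 v2 v3 _] := basis_opP e e_unc (C * l) u Cl0.
  move=> n c; have /andP[_ /le_trans] := equ n c; apply.
  rewrite -mulrA ler_wpM2l ?(ltW C0) //.
  under eq_bigr do rewrite scalerA; apply: dom => k.
  by rewrite normrM normr_nat ler_piMr // lern1 leq_b1.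
exists (basis_op e u), C; split => //.
- split; first by split => //; exists (C * l).
  exists r => // n m dnm; rewrite v3 /u biorthZ // biorth_basis //.
  have [nA|] := boolP (n \in A); last by rewrite mul0r.
  have [mn|] := eqVneq m (sigma n); last by rewrite mulr0.
  by move: dnm; rewrite mn ltNge close //; exact: set_mem.
- by move=> i /mem_set iA; rewrite v3 /u iA scale1r.
(* The lower half of the equivalence, tested on the single vector [e i], compares the two norms. *)
- move=> i /mem_set iA; have := equ i.+1 (fun k => (k == i)%:R).
  have single (w : nat -> E) :
      \sum_(0 <= k < i.+1) (k == i)%:R *: ((k \in A)%:R *: w k) = w i.
    rewrite big_nat_recr //= eqxx iA !scale1r big1_seq ?add0r // => k.
    by rewrite mem_index_iota => /andP[_ /andP[_ ki]]; rewrite ltn_eqF // scale0r.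
  by rewrite !single => /andP[+ _]; rewrite ler_pdivrMl.
Qed.

End PartialTranslation.

(** * Sequences of pairs witnessing a failure of coarseness *)

Section EscapingPairs.
Context {R : realType} (d g : nat -> nat -> R).
Hypotheses (d_metric : is_metric d) (d_ulf : uniformly_locally_finite d).

(** Balls are finite, so all these pairs lie in the finite square of [U]. The sum of [g] in absolute
    value over that square, plus 1 for strictness, is a bound. *)
Lemma near_pairs_bounded (r : R) N : 0 < r -> exists2 s : R, 0 < s &
  forall x y, d x y < r -> (x <= N)%N || (y <= N)%N -> g x y < s.
Proof.
move=> r0; have [n ball] := d_ulf r r0; have [_ _ dC _] := d_metric.
pose U := `I_N.+1 `|` \bigcup_(x in `I_N.+1) [set y | d x y <= r].
have fU : finite_set U.
  rewrite finite_setU; split; first exact: finite_II.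
  apply: bigcup_finite => [|x _]; first exact: finite_II.
  exact: card_le_finite (ball x) (finite_II n).
have UX x y : d x y < r -> (x <= N)%N -> U x /\ U y.
  by move=> /ltW xy xN; split; [left|right; exists x].
have /finite_seqP[s sU] := finite_setX fU fU.
have sum_ge0 (t : seq (nat * nat)) : 0 <= \sum_(p <- t) `|g p.1 p.2| by exact: sumr_ge0.
exists (\sum_(p <- s) `|g p.1 p.2| + 1); first by rewrite ltr_wpDl.
move=> x y xy near; have : (U `*` U) (x, y).
  case/orP: near => [/(UX _ _ xy)//|yN].
  by have [|] := UX y x _ yN; first by rewrite dC.
rewrite sU /= => /(big_rem (x, y)) ->; apply: (@le_lt_trans _ _ `|g x y|); first exact: ler_norm.
by rewrite -addrA ltrDl ltr_wpDl.
Qed.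

(** Used with [g x y = d' (s x) (s y)]. Each new pair is chosen with both entries beyond all earlier
    ones, which gives injectivity. *)
Lemma escaping_pairs (r : R) : 0 < r ->
  ~ (exists2 s, 0 < s & forall x y, d x y < r -> g x y < s) ->
  exists x y : nat -> nat, [/\ injective x, injective y,
    forall k, d (x k) (y k) < r & forall k, k%:R <= g (x k) (y k)].
Proof.
move=> r0 unb.
have far N : exists p : nat * nat,
    [/\ (N < p.1)%N, (N < p.2)%N, d p.1 p.2 < r & N%:R <= g p.1 p.2].
  (* If no such pair exists beyond [N], then [g] is below [N] on the far pairs and below [s] on the
     others, hence uniformly bounded. *)
  apply: contrapT => none; apply: unb; have [s s0 near] := near_pairs_bounded r N r0.
  exists (s + N.+1%:R); first by rewrite ltr_wpDr.
  move=> x y xy; have [nxy|] := boolP ((x <= N)%N || (y <= N)%N).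
    by rewrite ltr_wpDr // near.
  rewrite negb_or -!ltnNge => /andP[xN yN].
  have [gN|gN] := ltP (g x y) N%:R; last by exfalso; apply: none; exists (x, y).
  by apply: (lt_le_trans gN); rewrite ler_wpDl ?(ltW s0) // ler_nat.
have [p pP] := choice far.
(* The next threshold is the larger entry of the current pair, so entries strictly increase with
   [k]; also [k <= N k], which weakens the bound [N k] on [g] to [k]. *)
pose N k := iter k (fun n => maxn (p n).1 (p n).2) 0%N.
have Nx k : (N k < (p (N k)).1 <= N k.+1)%N by have [? _ _ _] := pP (N k); rewrite leq_maxl andbT.
have Ny k : (N k < (p (N k)).2 <= N k.+1)%N by have [_ ? _ _] := pP (N k); rewrite leq_maxr andbT.
have kN k : (k <= N k)%N.
  by elim: k => // k IH; have /andP[h1 h2] := Nx k; rewrite (leq_ltn_trans IH) // (leq_trans h1).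
have inj (z : nat -> nat) : (forall k, (N k < z k <= N k.+1)%N) -> injective z.
  move=> zN; have mono : {homo z : i j / (i < j)%N}.
    apply: homo_ltn; first exact: ltn_trans.
    move=> k; have /andP[_ h1] := zN k; have /andP[h2 _] := zN k.+1.
    exact: leq_ltn_trans h1 h2.
  by move=> i j; case: (ltngtP i j) => // /mono; rewrite ltn_neqAle => /andP[/eqP h _] zij; case: h.
exists (fun k => (p (N k)).1), (fun k => (p (N k)).2); split; [exact: inj Nx|exact: inj Ny| |].
  by move=> k; have [] := pP (N k).
by move=> k; have [_ _ _] := pP (N k); apply: le_trans; rewrite ler_nat.
Qed.

End EscapingPairs.

(** * Coarseness from comparison of corners *)

Section CoarseTransport.
Context {R : realType} {E F : completeNormedModType R[i]} (e : nat -> E) (f : nat -> F).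
Context (d d' : nat -> nat -> R).
Hypotheses (d_metric : is_metric d) (d_ulf : uniformly_locally_finite d).
Hypotheses (e_sym : symmetric_basis d e) (f_unc : unconditional_basis f).

(** Stated for an arbitrary map [T] so that it serves both [Phi] with [s] and [Psi] with the inverse
    permutation; [M] is then a norm bound for the opposite map. *)
Lemma coarse_of_corner_bound (T : (E -> E) -> (F -> F)) (s : nat -> nat) (M : R) :
  (forall v, uniform_roe d e v -> uniform_roe d' f (T v)) ->
  (forall v x y, uniform_roe d e v ->
    opnorm (diag_op e [set y] \o v \o diag_op e [set x]) <=
      M * opnorm (diag_op f [set s y] \o T v \o diag_op f [set s x])) ->
  coarse d d' s.
Proof.
move=> Troe corner r r0; apply: contrapT => /(escaping_pairs _ _ d_metric d_ulf _ r0).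
case=> x [y [x_inj y_inj close escape]].
have e_unc := e_sym.1.
(* The inverse of [x] on its range followed by [y]; the default 0 is reached only off that range. *)
pose sigma i := y (xget 0%N [set k | x k = i]).
have sigmax k : sigma (x k) = y k.
  by rewrite /sigma; congr y; case: xgetP => [j _ /x_inj//|/(_ k)[]].
have bij_sigma : set_bij (range x) (range y) sigma.
  split; first by move=> _ [k _ <-]; exists k.
    move=> i j /set_mem[k _ <-] /set_mem[l _ <-]; rewrite !sigmax.
    by move=> /y_inj ->.
  by move=> _ [k _ <-]; exists (x k).
have [|v [C [band_v C0 ve eC]]] := partial_translation _ _ e_sym _ _ _ _ r0 bij_sigma.
  by move=> _ [k _ <-]; rewrite sigmax ltW.
have [l l0 lP] := diag_opP _ f_unc.
have roe_v := band_roe _ _ _ band_v.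
pose M1 := `|M| + 1; have M0 : 0 < M1 by rewrite ltr_wpDl.
(* The losses are [C] for comparing basis vectors, [M1] for comparing corners, and [l] for each of
   the two projections; this error forces [C * opnorm a < 1] below. *)
have eps0 : 0 < (C * (M1 * (l * l)))^-1 by rewrite invr_gt0 !mulr_gt0.
have [bTv /(_ _ eps0)[b [bb [rb rb0 bandb]] small]] := Troe _ roe_v.
pose k := Num.bound rb.
have rbk : rb < d' (s (x k)) (s (y k)).
  by apply: lt_le_trans (escape k); exact: archi_boundP (ltW rb0).
(* The index [k] puts the pair beyond the width [rb], so this corner of [b] vanishes and the corner
   of [T v] equals that of [T v - b]. *)
have corner0 z : diag_op f [set s (y k)] (b (diag_op f [set s (x k)] z)) = 0.
  by rewrite !diag_set1 // bounded_operatorZ // biorthZ // bandb // mulr0 scale0r.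
have bsub := bounded_operator_sub _ _ bTv bb.
have upper : opnorm (diag_op f [set s (y k)] \o T v \o diag_op f [set s (x k)]) <=
    l * l * opnorm (T v - b).
  apply: opnorm_le => [|z]; first by rewrite !mulr_ge0 ?opnorm_ge0 // ltW.
  have [_ ly _] := lP [set s (y k)]; have [_ lx _] := lP [set s (x k)].
  rewrite /= -[X in rnorm X]subr0 -(corner0 z) -bounded_operatorB; last exact: bounded_diag.
  apply: le_trans (ly _) _; rewrite -!mulrA ler_wpM2l ?(ltW l0) //.
  apply: le_trans (ler_opnorm (T v - b) _ bsub) _.
  by rewrite mulrCA ler_wpM2l ?opnorm_ge0.
pose a := diag_op e [set y k] \o v \o diag_op e [set x k].
have ba : bounded_operator a.
  apply: bounded_operator_comp; last exact: bounded_diag.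
  by apply: bounded_operator_comp; [exact: bounded_diag|case: band_v].
have ae : a (e (x k)) = e (y k).
  by rewrite /a /= diag_basis // mem_set // scale1r ve ?sigmax ?diag_basis ?mem_set ?scale1r.
have ey0 := rnorm_basis_gt0 _ e_unc (y k).
(* This inequality is refuted: its right-hand side is at most [opnorm a * C * rnorm (e (y k))],
   which is less than [rnorm (e (y k))]. *)
have := ler_opnorm a (e (x k)) ba; rewrite ae; apply/negP; rewrite -ltNge.
have exC : rnorm (e (x k)) <= C * rnorm (e (y k)) by rewrite -[y k]sigmax; apply: eC.
apply: le_lt_trans (ler_wpM2l (opnorm_ge0 _ ba) exC) _.
rewrite mulrA gtr_pMl // -ltr_pdivlMr // div1r.
have a_le : opnorm a <= M1 * (l * l) * opnorm (T v - b).
  apply: le_trans (corner v (x k) (y k) roe_v) _; rewrite -mulrA.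
  apply: le_trans (ler_wpM2l (ltW M0) upper).
  rewrite ler_wpM2r ?opnorm_ge0 //; last by have := ler_norm M; rewrite /M1; lra.
  apply: bounded_operator_comp; last exact: bounded_diag.
  by apply: bounded_operator_comp; first exact: bounded_diag.
apply: le_lt_trans a_le _; have Ml0 : 0 < M1 * (l * l) by rewrite !mulr_gt0.
by rewrite mulrC -ltr_pdivlMr // -invfM.
Qed.

End CoarseTransport.

(** Expansion of [s] is the contrapositive of coarseness of [t], and surjectivity makes every
    distance to the range 0. *)
Lemma bijective_coarse_equivalence {R : realType} {X Y : Type} (d : X -> X -> R)
    (d' : Y -> Y -> R) (s : X -> Y) (t : Y -> X) :
  is_metric d' -> cancel s t -> cancel t s -> coarse d d' s -> coarse d' d t ->
  bijectively_coarsely_equivalent d d'.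
Proof.
move=> [d'_ge0 d'0 _ _] st ts s_coarse t_coarse; exists s; first by exists t.
split; first split => //.
  (* Coarseness takes a strict inequality while the contrapositive supplies only [<= eps], hence
     [eps + 1]. *)
  move=> eps eps0; have [|r r0 tr] := t_coarse (eps + 1); first by rewrite ltr_wpDr.
  exists r => // x y; rewrite !ltNge; apply: contra => xy.
  by rewrite -[x]st -[y]st ltW // tr // (le_lt_trans xy) // ltrDl.
exists 0 => _ [y _ <-]; have [_ /(_ erefl) dyy] := d'0 y y; rewrite -dyy.
apply: ge_inf; first by exists 0 => _ [z _ <-].
by exists y => //; exists (t y).
Qed.

(** * The permutation induced by the isomorphism *)

Section Isomorphism.
Context {R : realType} {E F : completeNormedModType R[i]} (e : nat -> E) (f : nat -> F).
Context (d d' : nat -> nat -> R) (Phi : (E -> E) -> (F -> F)) (Psi : (F -> F) -> (E -> E)).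
Hypotheses (d_metric : is_metric d) (d'_metric : is_metric d').
Hypotheses (e_unc : unconditional_basis e) (f_unc : unconditional_basis f).
Hypothesis Phi_hom : algebra_hom_on (uniform_roe d e) Phi.
Hypothesis Phi_inv : inverse_on (uniform_roe d e) (uniform_roe d' f) Phi Psi.
Hypothesis Phi_pos : positive_on e f (uniform_roe d e) Phi.

Let roe_diag A : uniform_roe d e (diag_op e A).
Proof. by apply: band_roe; exact: band_diag. Qed.

Let roe_diag' A : uniform_roe d' f (diag_op f A).
Proof. by apply: band_roe; exact: band_diag. Qed.

Let roe_id : uniform_roe d e id.
Proof. by rewrite -(diag_setT e). Qed.

Let roe_id' : uniform_roe d' f id.
Proof. by rewrite -(diag_setT f). Qed.

(** Multiplicativity is applied to [id] and [Psi id]: the product is [Psi id], and [Phi] sends it to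
    [id]. *)
Lemma iso_id : Phi id = id.
Proof.
have [_ _ PhiM] := Phi_hom; have [_ PsiA _ PhiK] := Phi_inv.
by have := PhiM _ _ roe_id (PsiA _ roe_id'); rewrite [X in Phi X]/comp PhiK.
Qed.

Lemma iso_diag A : exists S, Phi (diag_op e A) = diag_op f S.
Proof.
have [PhiD _ PhiM] := Phi_hom; have [PhiB _ _ _] := Phi_inv.
apply: (positive_idempotent_diag f f_unc (Phi (diag_op e (~` A)))).
- by case: (PhiB _ (roe_diag A)).
- by rewrite -PhiD // addrC diagD_setC // iso_id.
- by apply: Phi_pos => //; exact: diag_positive.
- by apply: Phi_pos => //; exact: diag_positive.
- by rewrite -PhiM // diag_comp // setIid.
Qed.

(** Both sides are [0 *: id], so homogeneity and [iso_id] suffice. *)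
Lemma iso_diag0 : Phi (diag_op e set0) = diag_op f set0.
Proof.
have diag0 (V : completeNormedModType R[i]) (v : nat -> V) : unconditional_basis v ->
    diag_op v set0 = 0 *: id.
  move=> v_unc; apply/funext => x; apply: (biorth_inj _ v_unc) => m.
  by rewrite biorth_diag // in_set0 biorthZ.
have [_ PhiZ _] := Phi_hom.
by rewrite !diag0 // PhiZ // iso_id.
Qed.

Lemma diag_op_inj (A B : set nat) : diag_op e A = diag_op e B -> A = B.
Proof.
move=> AB; apply/funext => n; apply/propext.
have := congr1 (fun a => biorth e n (a (e n))) AB.
rewrite !diag_basis // !biorthZ // biorth_basis // eqxx !mulr1 => /eqP.
rewrite eqr_nat => /eqP h0; have h : (n \in A) = (n \in B) by case: (n \in A) (n \in B) h0 => -[].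
by split => /mem_set nA; apply: set_mem; [rewrite -h|rewrite h].
Qed.

Let Phi_inj a b : uniform_roe d e a -> uniform_roe d e b -> Phi a = Phi b -> a = b.
Proof. by have [_ _ PsiK _] := Phi_inv => ra rb /(congr1 Psi); rewrite !PsiK. Qed.

Lemma iso_corner v A B : uniform_roe d e v ->
  Phi (diag_op e A \o v \o diag_op e B) =
  Phi (diag_op e A) \o Phi v \o Phi (diag_op e B).
Proof.
move=> rv; have [_ _ PhiM] := Phi_hom.
have rl : uniform_roe d e (diag_op e A \o v) by exact: roe_diagl.
by rewrite (PhiM _ _ rl (roe_diag B)) (PhiM _ _ (roe_diag A) rv).
Qed.

Lemma iso_diag1 n : exists s, Phi (diag_op e [set n]) = diag_op f [set s].
Proof.
have [S PhiS] := iso_diag [set n].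
have [_ PhiZ PhiM] := Phi_hom; have [PhiB PsiA PsiK PhiK] := Phi_inv.
have [S0|/set0P[s Ss]] := eqVneq S set0.
  have /diag_op_inj n0 : diag_op e [set n] = diag_op e set0.
    by apply: Phi_inj => //; rewrite PhiS S0 iso_diag0.
  by have : set0 n by rewrite -n0.
exists s; rewrite PhiS.
(* [D_n q D_n] is a multiple [c D_n] of [D_n]; its image is both [c D_S] and
   [D_S D_s D_S = D_s], which forces [c = 1] and [S = {s}]. *)
pose q := Psi (diag_op f [set s]); pose c := biorth e n (q (e n)).
have corner : diag_op e [set n] \o q \o diag_op e [set n] = c *: diag_op e [set n].
  have bq : bounded_operator q by case: (PsiA _ (roe_diag' [set s])).
  apply/funext => x; rewrite -[RHS]/(c *: diag_op e [set n] x) /= !diag_set1 //.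
  by rewrite bounded_operatorZ // biorthZ // scalerA mulrC.
have := iso_corner q [set n] [set n] (PsiA _ (roe_diag' _)).
rewrite corner PhiZ // PhiK // PhiS !diag_comp // setIAC setIid.
have -> : S `&` [set s] = [set s] by apply/seteqP; split => [? []//|? ->].
move=> /[dup] cS; move/(congr1 (fun a => biorth f s (a (f s)))).
rewrite -[(c *: diag_op f S) (f s)]/(c *: diag_op f S (f s)) !diag_basis //.
rewrite (mem_set Ss) (mem_set (erefl s : [set s] s)) !scale1r.
by rewrite biorthZ // biorth_basis // eqxx mulr1 => c1; rewrite -cS c1 scale1r.
Qed.

Lemma iso_permutation : exists s t : nat -> nat, [/\ cancel s t, cancel t s &
  forall n, Phi (diag_op e [set n]) = diag_op f [set s n]].
Proof.
have [s sP] := choice iso_diag1.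
have [_ _ PhiM] := Phi_hom; have [PhiB PsiA PsiK PhiK] := Phi_inv.
have s_inj : injective s.
  move=> m n smn; have /diag_op_inj mn : diag_op e [set m] = diag_op e [set n].
    by apply: Phi_inj => //; rewrite !sP smn.
  by have : [set n] m by rewrite -mn.
have s_surj k : exists n, s n = k.
  apply: contrapT => none.
  pose q := Psi (diag_op f [set k]); have rq : uniform_roe d e q by exact: PsiA.
  (* For [k] outside the range of [s], every [D_n q] is sent to [D_(s n) D_k = 0]. All coordinates
     of [q x] therefore vanish, so [q = 0], although its image [D_k] is nonzero. *)
  have Dq n : diag_op e [set n] \o q = diag_op e set0.
    apply: Phi_inj => //; first exact: roe_diagl.
    rewrite PhiM // sP PhiK // diag_comp // iso_diag0; congr diag_op.
    by rewrite -subset0 => j [/= -> nk]; apply: none; exists n.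
  have q0 : q = diag_op e set0.
    apply/funext => x; apply: (biorth_inj _ e_unc) => n.
    rewrite -(Dq n) /= biorth_diag // mem_set // mul1r //.
  have := congr1 Phi q0; rewrite PhiK // iso_diag0.
  move/(congr1 (fun a => biorth f k (a (f k)))).
  rewrite !diag_basis // mem_set // in_set0 scale1r scale0r biorth_basis // biorth0 // eqxx.
  by move/eqP; rewrite oner_eq0.
have [t tP] := choice s_surj.
by exists s, t; split => // n; apply: s_inj; rewrite tP.
Qed.

End Isomorphism.

(** * Coarseness of the permutation and of its inverse *)

Theorem theorem5p10 (R : realType) (d d' : nat -> nat -> R)
    (E F : completeNormedModType R[i]) (e : nat -> E) (f : nat -> F)
    (d_metric : is_metric d) (d'_metric : is_metric d')
    (d_ulf : uniformly_locally_finite d) (d'_ulf : uniformly_locally_finite d')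
    (e_sym : symmetric_basis d e) (f_sym : symmetric_basis d' f)
    (iso : exists Phi : (E -> E) -> (F -> F),
      banach_algebra_iso (uniform_roe d e) (uniform_roe d' f) Phi /\
      order_iso e f (uniform_roe d e) (uniform_roe d' f) Phi) :
  bijectively_coarsely_equivalent d d'.
Proof.
have [e_unc _] := e_sym; have [f_unc _] := f_sym.
have [Phi [[hom [Psi [inv [M PhiM] [N PsiN]]]] [_ [_ pos _]]]] := iso.
have [PhiB PsiA PsiK PhiK] := inv.
have [s [t [st ts sP]]] := iso_permutation _ _ _ _ _ _ d_metric d'_metric e_unc f_unc hom inv pos.
have corner v x y : uniform_roe d e v ->
    Phi (diag_op e [set y] \o v \o diag_op e [set x]) =
    diag_op f [set s y] \o Phi v \o diag_op f [set s x].
  by move=> rv; rewrite (iso_corner e d Phi) // !sP.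
have roe_corner v x y : uniform_roe d e v ->
    uniform_roe d e (diag_op e [set y] \o v \o diag_op e [set x]).
  by move=> rv; apply: roe_diagr => //; exact: roe_diagl.
apply: (bijective_coarse_equivalence d d' s t) => //.
  (* The corner is [Psi] of its image under [Phi], so the bound [N] of [Psi] compares the two. *)
  apply: (coarse_of_corner_bound e f d d' _ _ _ _ Phi s N) => // v x y rv.
  rewrite -corner // -{1}[X in opnorm X <= _]PsiK; last exact: roe_corner.
  by apply/PsiN/PhiB; exact: roe_corner.
(* Multiplicativity of [Phi] serves here as well: it sends the corner of [Psi v] at [t x], [t y] to
   that of [v] at [x], [y], with bound [M]. *)
apply: (coarse_of_corner_bound f e d' d _ _ _ _ Psi t M) => // v x y rv.
have rPv := PsiA _ rv; apply: le_trans (PhiM _ (roe_corner _ _ _ rPv)).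
by rewrite corner // !ts PhiK.
Qed.
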